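(* Assume that $\omega_1=\mathfrak{t}<\mathfrak{b}=\mathfrak{c}$ and that there exists a simple $P_{\mathfrak{c}}$-point. Then there exists a regular separable first countable countably compact space with more than one point on which every continuous real-valued function is constant (an $\mathbb{R}$-rigid Nyikos space).
   Context: Regular spaces are assumed to be $T_1$. A Nyikos space is a regular separable first countable countably compact space. A space $X$ is $\mathbb{R}$-rigid if every continuous map $X\to\mathbb{R}$ is constant. For $A,B\subset\omega$, $A\subset^*B$ means that $A\setminus B$ is finite. For a cardinal $\theta$, a family $\{T_\alpha\}_{\alpha\in\theta}$ of infinite subsets of $\omega$ is a tower (of length $\theta$) if $T_\alpha\subset^*T_\beta$ and $|T_\beta\setminus T_\alpha|=\omega$ for all $\alpha<\beta<\theta$. It is maximal if for every infinite $I\subset\omega$ there is $\alpha$ with $I\cap T_\alpha$ infinite. For a regular cardinal $\kappa$, an ultrafilter $\mathcal F$ on $\omega$ is a simple $P_\kappa$-point if it has a basis $\{F_\alpha:\alpha<\kappa\}$ such that $\{\omega\setminus F_\alpha:\alpha<\kappa\}$ is a tower of length $\kappa$. $\mathfrak t$ is the usual tower number (the least length of a maximal tower of infinite length), $\mathfrak b$ is the least cardinality of a $\le^*$-unbounded family in $\omega^\omega$, and $\mathfrak c=2^\omega$. *)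

(* Defs.v *)
From HB Require Import structures.
From mathcomp Require Import all_boot all_order all_algebra.
From mathcomp Require Import all_classical all_reals all_analysis.
From mathcomp Require wochoice.

Import numFieldNormedType.Exports.

Set Implicit Arguments.
Unset Strict Implicit.
Unset Printing Implicit Defensive.

Local Open Scope classical_set_scope.
Local Open Scope card_scope.

(* A cardinal is an initial ordinal: a well-ordered type (the order is the
   reflexive one) no proper initial segment of which is as large as the whole.
   Finite cardinals are included. *)
Record cardinal := Cardinal {
  ordinals_below :> Type;
  ord_le : rel ordinals_below;
  ord_le_wo : wochoice.well_order ord_le;
  ord_le_initial : forall a : ordinals_below,
    ~ ([set: ordinals_below] #<= [set b | ord_le b a /\ b <> a])
}.

Definition ord_lt (k : cardinal) (a b : k) : Prop := ord_le a b /\ a <> b.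

Definition cardinal_eq (k l : cardinal) : Prop := [set: k] #= [set: l].

Definition cardinal_le (k l : cardinal) : Prop := [set: k] #<= [set: l].

Definition cardinal_lt (k l : cardinal) : Prop :=
  cardinal_le k l /\ ~ cardinal_eq k l.

Definition infinite_cardinal (k : cardinal) : Prop := infinite_set [set: k].

Definition regular_cardinal (k : cardinal) : Prop :=
  infinite_cardinal k /\
  forall A : set k, (forall a, exists2 b, A b & ord_le a b) -> A #= [set: k].

Definition is_omega1 (k : cardinal) : Prop :=
  ~ countable [set: k] /\ forall a : k, countable [set b | ord_lt b a].

Definition is_continuum (k : cardinal) : Prop :=
  [set: k] #= [set: set nat].

Definition almost_subset (A B : set nat) : Prop := finite_set (A `\` B).

Definition tower (k : cardinal) (T : k -> set nat) : Prop :=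
  (forall a, infinite_set (T a)) /\
  forall a b, ord_lt a b ->
    almost_subset (T a) (T b) /\ infinite_set (T b `\` T a).

Definition maximal_tower (k : cardinal) (T : k -> set nat) : Prop :=
  tower T /\
  forall I : set nat, infinite_set I -> exists a, infinite_set (I `&` T a).

Definition infinite_length_of_maximal_tower (k : cardinal) : Prop :=
  infinite_cardinal k /\ exists T : k -> set nat, maximal_tower T.

Definition is_tower_number (k : cardinal) : Prop :=
  infinite_length_of_maximal_tower k /\
  forall l, infinite_length_of_maximal_tower l -> cardinal_le k l.

Definition le_star (f g : nat -> nat) : Prop :=
  \forall n \near \oo, (f n <= g n)%N.

Definition unbounded_family (B : set (nat -> nat)) : Prop :=
  ~ exists g, forall f, B f -> le_star f g.

Definition is_bounding_number (k : cardinal) : Prop :=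
  (exists2 B, unbounded_family B & B #= [set: k]) /\
  forall B, unbounded_family B -> [set: k] #<= B.

Definition simple_P_point (k : cardinal) (F : set_system nat) : Prop :=
  [/\ regular_cardinal k, UltraFilter F &
    exists B : k -> set nat,
      F = filter_from [set: k] B /\ tower (fun a => ~` B a)].

Definition separable_space (X : topologicalType) : Prop :=
  exists2 D : set X, countable D & dense D.

Definition first_countable (X : topologicalType) : Prop :=
  forall x : X, exists2 B : set (set X), countable B & nbhs x = filter_from B id.

Definition countably_compact (X : topologicalType) : Prop :=
  forall U : nat -> set X, (forall n, open (U n)) ->
    [set: X] `<=` cover [set: nat] U ->
    finite_subset_cover [set: nat] U [set: X].

(* The library's regular_space does not include T1. *)
Definition Nyikos_space (X : topologicalType) : Prop :=
  (regular_space X /\ accessible_space X) /\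
  [/\ separable_space X, first_countable X & countably_compact X].

Definition R_rigid (R : realType) (X : topologicalType) : Prop :=
  forall f : X -> R, continuous f -> forall x y, f x = f y.

(* Main.v *)
From HB Require Import structures.
Require Import Defs.
From mathcomp Require Import all_boot all_order all_algebra.
From mathcomp Require Import all_classical all_reals all_analysis.

Import Order.TTheory GRing.Theory Num.Theory.
Import numFieldNormedType.Exports.

Set Implicit Arguments.
Unset Strict Implicit.
Unset Printing Implicit Defensive.

Local Open Scope classical_set_scope.
Local Open Scope nat_scope.

(* The space is [seq nat] together with one point for every stage [xi < c].  On
   [seq nat] a basic neighbourhood of [e] consists of [e] and of all extensions
   of [e] whose next entry is at least [k].  Every [g : seq nat] carries a copy
   of the P-point [F] on its ray [g, g0, g00, ...]; these copies converge to no
   point, but every neighbourhood of a point of [seq nat] belongs to one of them.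

   At stage [xi] a pair of sequences along [F] is given a common limit.  Since
   fewer than [c] neighbourhoods exist so far and [F] is a simple P_c-point, one
   member of its base decides all of them; since [b = c], neighbourhoods of the
   terms can be chosen to shrink fast enough for the new point to preserve
   regularity.  Using a gap between two members of the base instead of a member
   keeps all copies of [F] divergent.

   Bookkeeping treats every pair of sequences cofinally often.  Sequences
   without [F]-limit acquire cluster points, so the space is countably compact.
   Rays of adjacent [g, g'] acquire common limits inside every member of [F], so
   a continuous real function has the same [F]-limit on both, hence on all rays,
   hence is constant on the dense set [seq nat]. *)

(** * Initial ordinals as well-orders *)

Section WellOrder.
Variable k : cardinal.
Implicit Types a b c : k.

Lemma ord_min (P : set k) : P !=set0 ->
  exists2 a, P a & forall b, P b -> ord_le a b.
Proof.
move=> [x Px]; have [|a [[Pa min] _]] := @ord_le_wo k [pred x | `[< P x >]].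
  by exists x; apply/asboolP.
exists a; first exact/asboolP.
by move=> b Pb; apply: min; apply/asboolP.
Qed.

Lemma ord_le_refl a : ord_le a a.
Proof. by have [|b -> min] := @ord_min [set a]; [exists a|exact: min]. Qed.

Lemma ord_le_anti a b : ord_le a b -> ord_le b a -> a = b.
Proof.
move=> ab ba; have [|c [_ uniq]] := @ord_le_wo k [pred x | `[< x = a \/ x = b >]].
  by exists a; apply/asboolP; left.
rewrite -(uniq a) ?(uniq b) //; split; try by apply/asboolP; tauto.
- by move=> x /asboolP[]-> //; exact: ord_le_refl.
- by move=> x /asboolP[]-> //; exact: ord_le_refl.
Qed.

Lemma ord_le_or_lt a b : ord_le a b \/ ord_lt b a.
Proof.
have [|c cE min] := @ord_min [set x | x = a \/ x = b]; first by exists a; left.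
have [->|ab] := pselect (a = b); first by left; exact: ord_le_refl.
case: cE min => -> min; first by left; apply: min; right.
by right; split; [apply: min; left|exact: nesym].
Qed.

Lemma ord_lt_irrefl a : ~ ord_lt a a.
Proof. by case. Qed.

Lemma ord_le_trans a b c : ord_le a b -> ord_le b c -> ord_le a c.
Proof.
move=> ab bc.
have [|x xE min] := @ord_min [set x | [\/ x = a, x = b | x = c]].
  by exists a; constructor 1.
case: xE min => -> min; first by apply: min; constructor 3.
  by rewrite (ord_le_anti ab (min a _)) //; constructor 1.
by rewrite -(ord_le_anti bc (min b _)) //; constructor 2.
Qed.

Lemma ord_le_lt_trans a b c : ord_le a b -> ord_lt b c -> ord_lt a c.
Proof.
move=> ab [bc ne]; split; first exact: ord_le_trans bc.
by move=> E; apply: ne; apply: ord_le_anti => //; rewrite -E.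
Qed.

Lemma ord_lt_trans a b c : ord_lt a b -> ord_lt b c -> ord_lt a c.
Proof. by move=> [ab _]; exact: ord_le_lt_trans. Qed.

Lemma ord_lt_total a b : [\/ ord_lt a b, a = b | ord_lt b a].
Proof.
have [ab|] := ord_le_or_lt a b; last by constructor 3.
by have [->|ne] := pselect (a = b); [constructor 2|constructor 1].
Qed.

Lemma ord_lt_wf : well_founded (@ord_lt k).
Proof.
move=> a; apply: contrapT => na.
have [|b nb min] := @ord_min [set x | ~ Acc (@ord_lt k) x]; first by exists a.
apply: nb; constructor => c [cb ne]; apply: contrapT => /min bc.
by apply: ne; exact: ord_le_anti.
Qed.

End WellOrder.

(** * Neighbourhoods generated by the codes of the stages *)

Section Neighborhoods.
Variable K : cardinal.

Definition point : Type := (seq nat + K)%type.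

Definition code : Type := ((nat -> bool -> point) * (nat -> nat))%type.

Definition below (xi : K) (x : point) : Prop :=
  if x is inr eta then ord_lt eta xi else True.

Definition upto (xi : K) (x : point) : Prop := below xi x \/ x = inr xi.

(** A side condition of [nb], which is defined for arbitrary [C]: memberships at a new point then
    rest on earlier points only. *)
Definition progressive (C : K -> code) (xi : K) : Prop :=
  forall n b, below xi ((C xi).1 n b).

(* [nb C x k] is the [k]-th basic neighbourhood of [x].  For [C xi = (d, f)], the
   neighbourhoods of the new point [xi] are the unions of the sets
   [nb C (d n b) (f n + k)] over [n >= k], and [xi] is put into a neighbourhood
   of an older point exactly when almost all [d n b] are there. *)
Inductive nb (C : K -> code) : point -> nat -> point -> Prop :=
| nb_refl x k : nb C x k x
| nb_seq e k i r : k <= i -> nb C (inl e) k (inl (e ++ i :: r))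
| nb_lim x k xi N : progressive C xi -> below xi x ->
    (forall n b, N <= n -> nb C x k ((C xi).1 n b)) -> nb C x k (inr xi)
| nb_fan xi k n b y : progressive C xi -> below xi y -> k <= n ->
    nb C ((C xi).1 n b) ((C xi).2 n + k) y -> nb C (inr xi) k y.

Lemma below_trans xi eta x : below xi x -> ord_lt xi eta -> below eta x.
Proof. by case: x => //= a /ord_lt_trans; apply. Qed.

Lemma not_upto xi eta : ~ upto xi (inr eta) -> ord_lt xi eta.
Proof.
move=> n; case: (ord_lt_total xi eta) => // [e|l]; case: n.
  by right; rewrite e.
by left.
Qed.

Lemma upto_below xi eta x : upto xi x -> ord_lt xi eta -> below eta x.
Proof. by move=> [/below_trans h /h//|-> ]. Qed.

Lemma point_ind (P : point -> Prop) : (forall e, P (inl e)) ->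
  (forall xi, (forall y, below xi y -> P y) -> P (inr xi)) -> forall x, P x.
Proof.
move=> P0 PS [//|xi]; elim/(well_founded_ind (@ord_lt_wf K)): xi => xi IH.
by apply: PS => -[//|eta]; exact: IH.
Qed.

(** Unless both points lie in [seq nat], a pair is handled at the stage of its later point, the
    other one being older or equal. *)
Lemma point_pair_ind (S : K -> Prop) (Q : point -> point -> Prop) :
  (forall e e', Q (inl e) (inl e')) ->
  (forall xi, S xi -> (forall x y, below xi x -> below xi y -> Q x y) ->
    Q (inr xi) (inr xi) /\
    forall x, below xi x -> Q x (inr xi) /\ Q (inr xi) x) ->
  forall xi, (forall eta, ord_lt eta xi -> S eta) ->
  forall x y, below xi x -> below xi y -> Q x y.
Proof.
move=> Q0 QS xi; elim/(well_founded_ind (@ord_lt_wf K)): xi => xi IH Sxi.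
have step eta : ord_lt eta xi -> Q (inr eta) (inr eta) /\
    forall x, below eta x -> Q x (inr eta) /\ Q (inr eta) x.
  move=> h; apply: QS; first exact: Sxi.
  by apply: IH => // z hz; apply: Sxi; exact: ord_lt_trans h.
case=> [e|a] [e'|b] //= ha hb.
- by have [_ /(_ (inl e) I)[]] := step _ hb.
- by have [_ /(_ (inl e') I)[]] := step _ ha.
- case: (ord_lt_total a b) => [ab|<-|ba].
  + by have [_ /(_ (inr a) ab)[]] := step _ hb.
  + by have [] := step _ ha.
  + by have [_ /(_ (inr b) ba)[]] := step _ ha.
Qed.

Section Code.
Variable C : K -> code.

Lemma nb_mono x k y j : j <= k -> nb C x k y -> nb C x j y.
Proof.
move=> jk h; elim: h j jk => {x k y}.
- by move=> *; exact: nb_refl.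
- by move=> e k i r ki j jk; apply: nb_seq; exact: leq_trans ki.
- by move=> x k xi N p b _ IH j jk; apply: (@nb_lim _ _ _ _ N) => // n b' /IH; apply.
- move=> xi k n b y p by_ kn _ IH j jk; apply: (@nb_fan _ _ _ n b) => //.
    exact: leq_trans kn.
  by apply: IH; rewrite leq_add2l.
Qed.

Lemma nb_seqP e k e' : nb C (inl e) k (inl e') ->
  e' = e \/ exists i r, k <= i /\ e' = e ++ i :: r.
Proof.
move=> h; inversion h as [|? ? i r ? | |]; subst; first by left.
by right; exists i, r.
Qed.

(** The stages of centre and member determine which rule of [nb] applied; the bounds inside [nb_lim]
    and [nb_fan] exclude the others. *)
Lemma nb_limP x k xi : below xi x -> nb C x k (inr xi) ->
  progressive C xi /\ exists N, forall n b, N <= n -> nb C x k ((C xi).1 n b).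
Proof.
move=> bx h; inversion h as [| |? ? ? N|]; subst.
- by have /ord_lt_irrefl := bx.
- by split=> //; exists N.
- by have /ord_lt_irrefl := ord_lt_trans bx H0.
Qed.

Lemma nb_fanP xi k y : below xi y -> nb C (inr xi) k y ->
  progressive C xi /\
  exists n b, k <= n /\ nb C ((C xi).1 n b) ((C xi).2 n + k) y.
Proof.
move=> bx h; inversion h as [| |? ? ? N|? ? n b]; subst.
- by have /ord_lt_irrefl := bx.
- by have /ord_lt_irrefl := ord_lt_trans bx H0.
- by split=> //; exists n, b.
Qed.

(** A point outside [A] is later than both centres, so its membership is decided by its own late
    terms; an inclusion on [A] thus spreads by induction. *)
Lemma nb_sub_extend (A : set point) x y j k :
  (forall e, A (inl e)) ->
  (forall xi, ~ A (inr xi) -> below xi x /\ below xi y) ->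
  (forall z, A z -> nb C y j z -> nb C x k z) ->
  forall z, nb C y j z -> nb C x k z.
Proof.
move=> A0 AN sub; elim/point_ind => [e|xi IH]; first exact/sub/A0.
have [a|/AN[bx by_]] := pselect (A (inr xi)); first exact: sub.
move=> /(nb_limP by_)[p [N dN]]; apply: (@nb_lim _ _ _ _ N) => // n b Nn.
by apply: IH; [exact: p|exact: dN].
Qed.

(** A later point in both neighbourhoods would have an older term in both. *)
Lemma nb_disj_extend (A : set point) x y j k :
  (forall e, A (inl e)) ->
  (forall xi, ~ A (inr xi) -> below xi x /\ below xi y) ->
  (forall z, A z -> nb C y j z -> ~ nb C x k z) ->
  forall z, nb C y j z -> ~ nb C x k z.
Proof.
move=> A0 AN disj; elim/point_ind => [e|xi IH]; first exact/disj/A0.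
have [a|/AN[bx by_]] := pselect (A (inr xi)); first exact: disj.
move=> /(nb_limP by_)[p [N dN]] /(nb_limP bx)[_ [M dM]].
apply: (IH ((C xi).1 (maxn M N) true)); first exact: p.
  by apply: dN; rewrite leq_maxr.
by apply: dM; rewrite leq_maxl.
Qed.

End Code.

(** A derivation between points below [xi] visits only such points. This allows the codes to be
    chosen by recursion. *)
Lemma nb_local xi (C C' : K -> code) : (forall eta, ord_lt eta xi -> C eta = C' eta) ->
  forall x k y, below xi x -> below xi y -> nb C x k y -> nb C' x k y.
Proof.
move=> CC x k y bx by_ h; elim: h bx by_ => {x k y}.
- by move=> *; exact: nb_refl.
- by move=> *; exact: nb_seq.
- move=> x k eta N p b _ IH bx be; apply: (@nb_lim _ _ _ _ N) => //.
    by move=> n b'; rewrite -CC.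
  move=> n b' Nn; rewrite -CC //; apply: IH => //.
  exact: below_trans (p _ _) be.
- move=> eta k n b y p bey kn _ IH be by_; apply: (@nb_fan _ _ _ n b) => //.
    by move=> m b'; rewrite -CC.
  by rewrite -CC //; apply: IH => //; exact: below_trans (p _ _) be.
Qed.

(** * Rays and neighbourhoods inside [seq nat] *)

Definition ray (g : seq nat) (m : nat) : point := inl (g ++ nseq m 0).

Section Code.
Variable C : K -> code.

Lemma nb_seq_open e k e' : nb C (inl e) k (inl e') ->
  exists j, forall z, nb C (inl e') j z -> nb C (inl e) k z.
Proof.
move=> h; have := nb_seqP h => -[->|[i [r [ki ->]]]]; first by exists k.
exists 0; apply: (@nb_sub_extend _ [set z | exists e, z = inl e]).
- by move=> u; exists u.
- by [].
- move=> _ [u ->] /nb_seqP[->|[i' [r' [_ ->]]]]; first exact: nb_seq.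
  by rewrite -catA; exact: nb_seq.
Qed.

Lemma nb_seq_regular e k e' : ~ nb C (inl e) k (inl e') ->
  exists j, forall z, nb C (inl e') j z -> ~ nb C (inl e) k z.
Proof.
move=> h; exists (nth 0 e (size e')).+1.
apply: (@nb_disj_extend _ [set z | exists e, z = inl e]).
- by move=> u; exists u.
- by [].
- move=> _ [u ->] /nb_seqP[->//|[i [r [ei ue]]]] /nb_seqP[ue'|[i' [r' [ki' ue']]]].
    by move: ei; rewrite -ue' ue nth_cat ltnn subnn /= ltnn.
  have := congr1 (nth 0 ^~ (size e')) ue'.
  rewrite ue nth_cat ltnn subnn /= nth_cat.
  case: ltngtP => [lt1 ii|lt1 _|eqs].
  + by move: ei; rewrite ii ltnn.
  + apply: h; have := congr1 (take (size e')) ue'.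
    rewrite ue take_size_cat // take_cat ltnNge (ltnW lt1) /= => ->.
    move: lt1; rewrite -subn_gt0; case: (_ - _) => // n _ /=.
    exact: nb_seq.
  + move=> _; apply: h.
    have := congr1 (take (size e')) ue'.
    rewrite ue take_size_cat // take_cat eqs ltnn subnn take0 cats0 => ->.
    exact: nb_refl.
Qed.

Lemma nb_seq_T1 e e' : e <> e' -> ~ nb C (inl e) (nth 0 e' (size e)).+1 (inl e').
Proof.
move=> ee /nb_seqP[/esym//|[i [r [+ e'E]]]].
by rewrite e'E nth_cat ltnn subnn /= ltnn.
Qed.

Lemma nth_ray g m i : nth 0 (g ++ nseq m 0) i = nth 0 g i.
Proof.
rewrite nth_cat nth_nseq if_same; case: ltnP => // h.
by rewrite nth_default.
Qed.

Lemma nb_ray e k g m : size e < size g -> take (size e) g = e ->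
  k <= nth 0 g (size e) -> nb C (inl e) k (ray g m).
Proof.
move=> eg te kg; rewrite /ray -{1}(cat_take_drop (size e) g) te (drop_nth 0) //.
by rewrite -catA; apply: nb_seq.
Qed.

(** A positive index excludes the trailing zeros, so the entry leading out of [e] belongs to [g]. *)
Lemma nb_rayP e k g m : nb C (inl e) k.+1 (ray g m) -> ray g m <> inl e ->
  [/\ size e < size g, take (size e) g = e & k.+1 <= nth 0 g (size e)].
Proof.
move=> /nb_seqP[E|[i [r [ki E]]]] ne; first by case: ne; rewrite /ray E.
have gi : nth 0 g (size e) = i.
  by rewrite -(nth_ray g m) E nth_cat ltnn subnn.
have eg : size e < size g.
  by rewrite ltnNge; apply/negP => /(nth_default 0); rewrite gi => i0; rewrite i0 in ki.
split=> //; last by rewrite gi.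
have := congr1 (take (size e)) E.
by rewrite takel_cat ?(ltnW eg) // take_size_cat.
Qed.

Lemma nb_seq_miss e g m : ray g m <> inl e ->
  ~ nb C (inl e) (nth 0 g (size e)).+1 (ray g m).
Proof. by move=> ne /nb_rayP /(_ ne)[_ _]; rewrite ltnn. Qed.

(* The graph generated by this relation on [seq nat] is connected, while a
   neighbourhood [nb C x k.+1] containing [F]-most of a ray forces [nb C x k] to
   contain [F]-most of each adjacent ray. *)
Definition adjacent (g g' : seq nat) : Prop :=
  (exists h i, g = rcons h i /\ g' = rcons h i.+1) \/ g' = rcons g 0.

(** Membership hangs on a single entry of [g], which a step to an adjacent sequence changes by at
    most one; an appended zero cannot be that entry. *)
Lemma nb_seq_adjacent e k g g' m m' : adjacent g g' \/ adjacent g' g ->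
  nb C (inl e) k.+1 (ray g m) -> ray g m <> inl e -> nb C (inl e) k (ray g' m').
Proof.
have sib h i i' : i <= i'.+1 -> size e < size (rcons h i) ->
    take (size e) (rcons h i) = e -> k.+1 <= nth 0 (rcons h i) (size e) ->
    nb C (inl e) k (ray (rcons h i') m').
  rewrite size_rcons ltnS => ii eh; rewrite -cats1 takel_cat // => te kg.
  apply: nb_ray; rewrite ?size_rcons ?ltnS //; first by rewrite -cats1 takel_cat.
  move: kg; rewrite cats1 !nth_rcons; move: eh; rewrite leq_eqVlt.
  move=> /orP[/eqP->|->]; last exact: ltnW.
  by rewrite ltnn eqxx => ki; rewrite -ltnS; exact: leq_trans ii.
move=> adj /nb_rayP h /h[eg te kg].
case: adj => -[[h' [i [? ?]]]|?]; subst.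
- by apply: sib eg te kg; exact: leqW.
- apply: nb_ray; first by rewrite size_rcons ltnW.
    by rewrite -cats1 takel_cat // ltnW.
  by rewrite nth_rcons eg ltnW.
- exact: sib eg te kg.
- move: eg te kg; rewrite size_rcons ltnS leq_eqVlt => /orP[/eqP->|eg].
    by rewrite nth_rcons ltnn eqxx.
  rewrite -cats1 takel_cat ?(ltnW eg) // nth_cat eg => te kg.
  by apply: nb_ray => //; exact: ltnW.
Qed.

End Code.
End Neighborhoods.

(** * Finite uniformity and ultrafilters *)

Definition ev (P : nat -> Prop) : Prop := exists N, forall n, N <= n -> P n.

Lemma uniform_index (P : nat -> nat -> Prop) N :
  (forall n i j, i <= j -> P n i -> P n j) ->
  (forall n, n < N -> exists j, P n j) -> exists j, forall n, n < N -> P n j.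
Proof.
move=> mono; elim: N => [|N IH] PN; first by exists 0.
have [n /leqW|i Pi] := IH; first exact: PN.
have [j Pj] := PN N (ltnSn N).
exists (maxn i j) => n; rewrite ltnS leq_eqVlt => /orP[/eqP->|/Pi].
  by apply: mono Pj; exact: leq_maxr.
by apply: mono; exact: leq_maxl.
Qed.

Lemma uniform_index_bool (P : bool -> nat -> Prop) :
  (forall b i j, i <= j -> P b i -> P b j) ->
  (forall b, exists j, P b j) -> exists j, forall b, P b j.
Proof.
move=> mono PN; have [[i Pi] [j Pj]] := (PN true, PN false).
exists (maxn i j) => -[].
  by apply: mono Pi; exact: leq_maxl.
by apply: mono Pj; exact: leq_maxr.
Qed.

Section Ultra.
Variables (T : Type) (F : set_system T).
Hypothesis UF : UltraFilter F.

Lemma ultra_setU (A B : set T) : F (A `|` B) -> F A \/ F B.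
Proof.
move=> FAB; have [|FA] := in_ultra_setVsetC A UF; first by left.
by right; apply: filterS (filterI FAB FA) => x [[]].
Qed.

Lemma ultra_setC (A : set T) : ~ F A -> F (~` A).
Proof. by have [] := in_ultra_setVsetC A UF. Qed.

Lemma ultra_bigcup (P : nat -> set T) N :
  F [set x | exists n, n < N /\ P n x] -> exists2 n, n < N & F (P n).
Proof.
elim: N => [|N IH] FP.
  by have [x [n []]] := filter_ex FP.
have [|/IH[n nN Fn]|] := @ultra_setU [set x | exists n, n < N /\ P n x] (P N).
- apply: filterS FP => x [n []]; rewrite ltnS leq_eqVlt => /orP[/eqP->|nN] Px.
    by right.
  by left; exists n.
- by exists n => //; exact: leqW.
- by exists N.
Qed.

Lemma ultra_bool (P : bool -> set T) : F [set x | exists b, P b x] -> exists b, F (P b).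
Proof.
move=> FP; have [| |] := @ultra_setU (P true) (P false); last 2 first.
- by exists true.
- by exists false.
by apply: filterS FP => x [[] Px]; [left|right].
Qed.

End Ultra.

(** * Invariants of a stage and the separation properties they yield *)

Section Invariants.
Variables (K : cardinal) (F : set_system nat).
Hypotheses (UF : UltraFilter F) (F_free : forall A, finite_set A -> ~ F A).

Definition local (C : K -> code K) (xi : K) (x : point K) (k : nat) (y : point K) :=
  [/\ below xi x, below xi y & nb C x k y].

(** Stated through the older neighbourhoods [W] alone. [adm_open] and [adm_regular] ask the second
    component to grow fast, [adm_T1] forbids convergence to an older point, and [adm_miss] keeps the
    copies of [F] on rays from converging to the new point. *)
Record admissible (xi : K) (W : point K -> nat -> point K -> Prop) (c : code K) : Prop :=
  Admissible {
  adm_below : forall n b, below xi (c.1 n b);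
  adm_open : forall x k, ev (fun n => forall b, W x k (c.1 n b)) ->
    ev (fun n => forall b z, W (c.1 n b) (c.2 n) z -> W x k z);
  adm_regular : forall x k, ~ ev (fun n => forall b, W x k (c.1 n b)) ->
    ev (fun n => forall b z, W (c.1 n b) (c.2 n) z -> ~ W x k.+1 z);
  adm_T1 : forall x, exists k, ~ ev (fun n => forall b, W x k (c.1 n b));
  adm_miss : forall g, exists N,
    ~ F [set m | exists n b, N <= n /\ W (c.1 n b) (c.2 n) (ray K g m)] }.

Variable C : K -> code K.

Let adm (eta : K) : Prop := admissible eta (local C eta) (C eta).

Lemma adm_limP eta x k : adm eta -> below eta x ->
  nb C x k (inr eta) <-> ev (fun n => forall b, local C eta x k ((C eta).1 n b)).
Proof.
move=> a bx; split.
  move=> /(nb_limP bx)[p [N dN]]; exists N => n Nn b.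
  by split=> //; exact: dN.
move=> [N dN]; apply: (@nb_lim _ _ _ _ _ N) => //; first exact: adm_below a.
by move=> n b /dN /(_ b)[].
Qed.

Let uptoN (eta : K) (x y : point K) : upto eta x -> upto eta y ->
  forall xi, ~ upto eta (inr xi) -> below xi x /\ below xi y.
Proof. by move=> ux uy xi /not_upto h; split; exact: upto_below h. Qed.

Section Below.
Variable xi : K.
Hypothesis adm_xi : forall eta, ord_lt eta xi -> adm eta.

Lemma nb_open x y k : below xi x -> below xi y -> nb C x k y ->
  exists j, forall z, nb C y j z -> nb C x k z.
Proof.
move=> bx by_; move: k; move: xi adm_xi x y bx by_; apply: point_pair_ind.
  by move=> e e' k; exact: nb_seq_open.
move=> eta a IH; split; first by move=> k _; exists k => z; exact: nb_mono.
move=> x bx; split=> k.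
  move=> h; have /(adm_limP _ a bx) /(adm_open a)[N dN] := h; exists N.
  apply: (@nb_sub_extend _ _ (upto eta)); first by left.
    by apply: uptoN; [left|right].
  move=> z [bz|-> _]; last first.
    exact: h.
  move=> /(nb_fanP bz)[p [n [b [Nn /(nb_mono (leq_addr _ _)) nz]]]].
  by have [] := dN n Nn b z (And3 (p n b) bz nz).
move=> /(nb_fanP bx)[p [n [b [kn]]]] /(IH _ _ (p n b) bx)[j sub]; exists j.
apply: (@nb_sub_extend _ _ (upto eta)); first by left.
  by apply: uptoN; [right|left].
move=> z [bz /sub nz|-> _]; last exact: nb_refl.
exact: (nb_fan p bz kn nz).
Qed.

(** Separating costs one index at new points and none at points of [seq nat]. The sharper form
    matters for pairs of rays, where [nb_adjacent] already spends an index. *)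
Let step (y : point K) : nat := if y is inl _ then 0 else 1.

Lemma nb_regular_step x y k : below xi x -> below xi y -> ~ nb C x k y ->
  exists j, forall z, nb C y j z -> ~ nb C x (k + step y) z.
Proof.
move=> bx by_; move: k; move: xi adm_xi x y bx by_; apply: point_pair_ind.
  by move=> e e' k; rewrite addn0; exact: nb_seq_regular.
move=> eta a IH; split; first by move=> k /(_ (nb_refl _ _ _)).
move=> x bx; split=> k.
  rewrite (adm_limP _ a bx) addn1 => h; have [N dN] := adm_regular a h; exists N.
  apply: (@nb_disj_extend _ _ (upto eta)); first by left.
    by apply: uptoN; [left|right].
  move=> z [bz|-> _]; last first.
    move=> /(nb_mono (leqnSn _)) /(adm_limP _ a bx); exact: h.
  move=> /(nb_fanP bz)[p [n [b [Nn /(nb_mono (leq_addr _ _)) nz]]]] xz.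
  exact: (dN n Nn b z (And3 (p n b) bz nz) (And3 bx bz xz)).
move=> nx; have [k0 k0P] := adm_T1 a x.
have [N dN] := adm_regular a k0P.
pose P n j := k <= n -> forall b z,
  nb C x j z -> ~ nb C ((C eta).1 n b) ((C eta).2 n + k + step x) z.
have [n i j ij Pi kn b z xz|n nN|j jP] := @uniform_index P N.
- by apply: (Pi kn b z); exact: nb_mono xz.
- have [kn|nk] := leqP k n; last by exists 0; rewrite /P leqNgt nk.
  have [b i j ij Pi z xz|b|j jP] := @uniform_index_bool (fun b j => forall z,
      nb C x j z -> ~ nb C ((C eta).1 n b) ((C eta).2 n + k + step x) z).
  + by apply: Pi; exact: nb_mono xz.
  + apply: (IH _ _ (adm_below a n b) bx) => dx; apply: nx.
    exact: (nb_fan (adm_below a) bx kn dx).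
  + by exists j => _; exact: jP.
(* The part [k0.+1] also keeps the new point itself out of the neighbourhood of [x]. *)
exists (maxn j k0.+1); apply: (@nb_disj_extend _ _ (upto eta)); first by left.
  by apply: uptoN; [right|left].
move=> z [bz xz|-> + _]; last first.
  move=> /(nb_mono (leq_maxr _ _)) /(nb_mono (leqnSn _)).
  by move=> /(adm_limP _ a bx).
move=> /(nb_fanP bz)[p [n [b [Nn nz]]]].
have [nN|nN] := ltnP n N.
  apply: (jP n nN (leq_trans (leq_addr _ _) Nn) b z).
    by apply: nb_mono xz; exact: leq_maxl.
  by rewrite -addnA.
apply: (dN n nN b z); first by split=> //; apply: nb_mono nz; exact: leq_addr.
by split=> //; apply: nb_mono xz; exact: leq_maxr.
Qed.

Lemma nb_regular x y k : below xi x -> below xi y -> ~ nb C x k y ->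
  exists j, forall z, nb C y j z -> ~ nb C x k.+1 z.
Proof.
move=> bx by_ /(nb_regular_step bx by_)[j jP]; exists j => z /jP nz kz; apply: nz.
by apply: nb_mono kz; rewrite -addn1 leq_add2l; case: (y).
Qed.

Lemma nb_regular_seq x e k : below xi x -> ~ nb C x k (inl e) ->
  exists j, forall z, nb C (inl e) j z -> ~ nb C x k z.
Proof.
by move=> bx /(@nb_regular_step _ (inl e) _ bx I); rewrite addn0.
Qed.

Lemma nb_T1 x y : below xi x -> below xi y -> x <> y -> exists k, ~ nb C x k y.
Proof.
move: xi adm_xi x y; apply: point_pair_ind.
  move=> e e' ne; exists (nth 0 e' (size e)).+1; apply: nb_seq_T1 => E.
  by rewrite E in ne.
move=> eta a IH; split=> // x bx; split=> _.
  have [k kP] := adm_T1 a x; exists k.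
  by move=> /(adm_limP _ a bx).
have [k kP] := adm_T1 a x; have [N dN] := adm_regular a kP; exists N.
move=> /(nb_fanP bx)[p [n [b [Nn /(nb_mono (leq_addr _ _)) nx]]]].
exact: (dN n Nn b x (And3 (p n b) bx nx) (And3 bx bx (nb_refl _ _ _))).
Qed.

Lemma nb_miss x g : below xi x -> exists k, ~ F [set m | nb C x k (ray K g m)].
Proof.
case: x => [e _|eta /adm_xi a].
  exists (nth 0 g (size e)).+1 => Fm.
  apply: (@F_free [set m | ray K g m = inl e]).
    apply: (@sub_finite_set _ _ [set m | m = size e - size g]).
      move=> m -[<-]; by rewrite /= size_cat size_nseq addKn.
    exact: finite_set1.
  apply: filterS Fm => m nm /=; apply: contrapT => ne.
  exact: nb_seq_miss nm.
have [N FN] := adm_miss a g; exists N; apply: contra_not FN; apply: filterS.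
move=> m /= /(@nb_fanP _ _ _ _ (ray K g m) I)[p [n [b [Nn nz]]]]; exists n, b.
by split=> //; split=> //; apply: nb_mono nz; exact: leq_addr.
Qed.

(** Induction on the centre. By [adm_miss] the late terms of a new point cover an [F]-null part of
    the ray, so the ultrafilter selects the neighbourhood of one early term, to which the induction
    hypothesis applies. *)
Lemma nb_adjacent x g g' k : below xi x -> adjacent g g' \/ adjacent g' g ->
  F [set m | nb C x k.+1 (ray K g m)] -> F [set m | nb C x k (ray K g' m)].
Proof.
move=> bx adj; elim/point_ind: x bx k => [e _ k Fm|eta IH le k Fm].
  have [m [/= nm ne]] : exists m, nb C (inl e) k.+1 (ray K g m) /\ ray K g m <> inl e.
    apply: contrapT => h; apply: (@F_free [set m | m = size e - size g]).
      exact: finite_set1.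
    apply: filterS Fm => m nm /=; apply: contrapT => ne; apply: h; exists m.
    by split=> // -[E]; apply: ne; rewrite -E size_cat size_nseq addKn.
  by apply: filterS filterT => m' _; exact: nb_seq_adjacent nm ne.
have a := adm_xi le; have [N FN] := adm_miss a g.
pose P n b m := k < n /\ nb C ((C eta).1 n b) ((C eta).2 n + k.+1) (ray K g m).
have : F [set m | exists n, n < N /\ exists b, P n b m].
  apply: filterS (filterI Fm (ultra_setC UF FN)) => m [/=].
  move=> /(@nb_fanP _ _ _ _ (ray K g m) I)[p [n [b [kn nz]]]] no.
  exists n; split; last by exists b.
  rewrite ltnNge; apply/negP => Nn; apply: no; exists n, b; split=> //.
  by split=> //; apply: nb_mono nz; exact: leq_addr.
move=> /(ultra_bigcup UF)[n _] /(ultra_bool UF)[b Fb].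
have kn : k < n by have [m []] := filter_ex Fb.
have bd := adm_below a n b.
have : F [set m | nb C ((C eta).1 n b) ((C eta).2 n + k) (ray K g' m)].
  apply: IH => //; first exact: below_trans bd le.
  by rewrite -addnS; apply: filterS Fb => m [].
by apply: filterS => m; exact: (nb_fan (adm_below a) _ (ltnW kn)).
Qed.

End Below.
End Invariants.

(** * Small sets and bookkeeping below the continuum *)

Lemma finite_nat_bounded (A : set nat) : finite_set A -> exists N, forall n, A n -> n < N.
Proof.
move=> /finite_seqP[s ->]; exists (\max_(i <- s) i).+1 => n /= ns.
by rewrite ltnS; apply: (@leq_bigmax_seq _ s xpredT id).
Qed.

Lemma infinite_nat_unbounded (A : set nat) :
  infinite_set A -> forall n, exists2 m, n <= m & A m.
Proof.
move=> iA n; apply: contrapT => h; apply: iA; apply: (@sub_finite_set _ _ `I_n).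
  move=> m Am /=; rewrite ltnNge; apply/negP => nm; apply: h; by exists m.
exact: finite_II.
Qed.

Lemma not_card_le_countable (T : Type) (A : set T) :
  countable A -> ~ ([set: set nat] #<= A)%card.
Proof.
move=> cA h; have /countable_injP[f finj] : countable [set: set nat].
  exact: card_le_trans h cA.
(* Cantor's diagonal set along the injection [f]. *)
pose D := [set n | exists2 B, f B = n & ~ B n].
have [DD|nDD] := pselect (D (f D)); last by apply: (nDD); exists D.
by have [B /finj -> //] := DD; rewrite inE.
Qed.

Lemma card_setT_leP (T U : Type) (A : set U) :
  ([set: T] #<= A)%card <-> exists2 f : T -> U, injective f & forall x, A (f x).
Proof.
split=> [/card_leP[psi]|[f finj fA]].
  exists (fun x => set_val (psi (to_setT x))) => [x y /val_inj|x]; last exact: set_valP.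
  by move=> /(@inj _ _ _ psi _ _ (in_setT _) (in_setT _)) [].
apply: (@card_le_trans _ _ _ (f @` [set: T])).
  have /card_eqPle[] // : (f @` [set: T] #= [set: T])%card.
  by apply: inj_card_eq => x y _ _; exact: finj.
by apply: subset_card_le => _ [x _ <-].
Qed.

Section Small.
Variable K : cardinal.

(** Stands in for having fewer than [K] elements, in the form that merges many choices of base
    members into one. *)
Definition small (T : Type) (A : set T) : Prop :=
  forall phi : T -> K, exists beta, forall x, A x -> ord_lt (phi x) beta.

Lemma small_image (T U : Type) (f : T -> U) (A : set T) : small A -> small (f @` A).
Proof.
by move=> sA phi; have [beta P] := sA (phi \o f); exists beta => _ [x Ax <-]; exact: P.
Qed.

Hypotheses (K_regular : regular_cardinal K) (K_continuum : is_continuum K).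

(** An unbounded image would be cofinal, hence as large as [K] by regularity. *)
Lemma small_le (T : Type) (A : set T) : ~ ([set: K] #<= A)%card -> small A.
Proof.
move=> KA phi; apply: contrapT => nb.
apply: KA; apply: (@card_le_trans _ _ _ (phi @` A)); last exact: card_image_le.
have /card_eqPle[] // : (phi @` A #= [set: K])%card.
apply: K_regular.2 => a; apply: contrapT => h; apply: nb; exists a => x Ax.
by have [ax|//] := ord_le_or_lt a (phi x); case: h; exists (phi x) => //; exists x.
Qed.

Lemma small_countable (T : Type) (A : set T) : countable A -> small A.
Proof.
move=> cA; apply: small_le => KA; apply: (not_card_le_countable cA).
apply: card_le_trans KA; by have /card_eqPle[] := K_continuum.
Qed.

Lemma ord_no_max (a : K) : exists b, ord_lt a b.
Proof.
have [b bP] := @small_countable _ [set tt] (countableP _) (fun=> a).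
by exists b; exact: (bP tt).
Qed.

Lemma ord_max2 (a b : K) : exists c, ord_lt a c /\ ord_lt b c.
Proof.
have [c cP] := @small_countable _ [set: bool] (countableP _) (fun i => if i then a else b).
by exists c; split; [exact: (cP true I)|exact: (cP false I)].
Qed.

Lemma small_setU (T : Type) (A B : set T) : small A -> small B -> small (A `|` B).
Proof.
move=> sA sB phi; have [[a aP] [b bP]] := (sA phi, sB phi).
have [c [ac bc]] := ord_max2 a b; exists c => x [/aP|/bP] h; exact: ord_lt_trans h _.
Qed.

Lemma small_fst (T : Type) (J : countType) (A : set T) :
  small A -> small [set p : T * J | A p.1].
Proof.
move=> sA phi; have h x : exists b, forall j, ord_lt (phi (x, j)) b.
  have [b bP] := @small_countable _ [set: J] (countableP _) (fun j => phi (x, j)).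
  by exists b => j; exact: bP.
have [f fP] := choice h; have [b bP] := sA f.
by exists b => -[x j] /bP; exact: ord_lt_trans.
Qed.

Lemma small_below (xi : K) : small [set x | below xi x].
Proof.
have s1 : small [set eta | ord_lt eta xi] by exact/small_le/ord_le_initial.
have s2 := @small_countable _ [set: seq nat] (countableP _).
apply: (@eq_rect _ _ (@small (point K)) (small_setU (small_image inl s2) (small_image inr s1))).
apply/seteqP; split=> [x [[y _ <-]//|[y yx <-]//]|[e _|eta h]].
  by left; exists e.
by right; exists eta.
Qed.

Lemma initial_segment_not_full (xi : K) : ~ ([set: K] #<= [set eta | ord_le eta xi])%card.
Proof.
have [b xb] := ord_no_max xi => h; apply: (@ord_le_initial K b).
by apply: card_le_trans h _; apply: subset_card_le => e /= /ord_le_lt_trans; apply.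
Qed.

(** Since [b] equals [K], an unbounded family admits an injection from [K]; a left inverse of it
    takes every value on the family, contrary to smallness. *)
Lemma small_bounded (b : cardinal) (G : set (nat -> nat)) :
  is_bounding_number b -> cardinal_eq b K -> small G ->
  exists f, forall g, G g -> ev (fun n => g n <= f n).
Proof.
move=> [_ bG] bK sG; apply: contrapT => h.
have /bG bleG : unbounded_family G.
  move=> [f fP]; apply: h; exists f => g /fP [N _ NP]; exists N => n; exact: NP.
have : ([set: K] #<= G)%card.
  by apply: card_le_trans bleG; have /card_eqPle[] := bK.
move=> /card_setT_leP[psi psi_inj Gpsi].
have [a0 _] := infinite_setN0 K_regular.1.
have inv g : exists a, (exists a', psi a' = g) -> psi a = g.
  by have [[a ag]|ng] := pselect (exists a', psi a' = g); [exists a|exists a0].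
have [phi phiP] := choice inv; have [beta /(_ _ (Gpsi beta))] := sG phi.
by rewrite (psi_inj _ _ (phiP (psi beta) (ex_intro _ beta erefl))) => -[].
Qed.

(** Stages encode pairs of a stage and a task. Each task thus receives [K] many stages, too many for
    an initial segment. *)
Lemma cofinal_enumeration : exists task : K -> bool -> nat -> point K,
  forall s xi, exists2 eta, ord_lt xi eta & task eta = s.
Proof.
have /card_eqPle[/card_setT_leP[i i_inj _] /card_setT_leP[i' i'_inj _]] := K_continuum.
pose T : countType := (nat + bool * nat * (seq nat + nat))%type.
(* The [inl] part records the bits of the stage; the [inr] part records every term, literally or
   through the bits of its stage. *)
pose encode (p : K * (bool -> nat -> point K)) : set T := fun t =>
  match t with
  | inl m => i p.1 m
  | inr (b, n, u) =>
      match u, p.2 b n with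
      | inl e, inl e' => e = e'
      | inr m, inr eta => i eta m
      | _, _ => False
      end
  end.
have encode_inj : injective encode.
  move=> [a s] [a' s'] E; have {}E t : encode (a, s) t = encode (a', s') t by rewrite E.
  congr pair; first by apply: i_inj; apply/funext => m; exact: E (inl m).
  apply/funext => b; apply/funext => n.
  have El e := E (inr (b, n, inl e)); have Er m := E (inr (b, n, inr m)).
  rewrite /= in El Er; case: (s b n) (s' b n) El Er => [e|eta] [e'|eta'] El Er.
  - by have := El e; rewrite propeqE => -[->].
  - by have := El e; rewrite propeqE => -[/(_ erefl)].
  - by have := El e'; rewrite propeqE => -[_ /(_ erefl)].
  - by congr inr; apply: i_inj; apply/funext => m; exact: Er.
pose J p := i' (pickle @` encode p).
have J_inj : injective J.
  move=> p q /i'_inj E; apply: encode_inj; apply/funext => t; apply/propext.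
  suff sub p' q' : pickle @` encode p' = pickle @` encode q' -> encode p' t -> encode q' t.
    by split; exact: sub.
  move=> {}E pt; have : (pickle @` encode p') (pickle t) by exists t.
  by rewrite E => -[u qu /(pcan_inj pickleK) <-].
have inv xi : exists s, forall p, J p = xi -> p.2 = s.
  have [[p <-]|np] := pselect (exists p, J p = xi).
    by exists p.2 => q /J_inj ->.
  by exists (fun _ _ => inl [::]) => p Jp; case: np; exists p.
have [task taskP] := choice inv; exists task => s xi.
apply: contrapT => h; apply: (@initial_segment_not_full xi).
apply/card_setT_leP; exists (fun a => J (a, s)) => [a a' /J_inj []//|a /=].
have [//|lt] := ord_le_or_lt (J (a, s)) xi.
by case: h; exists (J (a, s)) => //; rewrite -(taskP _ (a, s)).
Qed.

End Small.

(** * A single stage: a common limit for a pair of sequences *)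

Section Stage.
Variables (K : cardinal) (F : set_system nat) (B : K -> set nat).
Hypotheses (K_regular : regular_cardinal K) (K_continuum : is_continuum K).
Hypothesis small_dominated : forall G : set (nat -> nat), small K G ->
  exists f, forall g, G g -> ev (fun n => g n <= f n).
Hypotheses (UF : UltraFilter F) (F_base : F = filter_from [set: K] B).
Hypothesis B_tower : tower (fun a => ~` B a).

Lemma base_in a : F (B a).
Proof. by rewrite F_base; exists a. Qed.

Lemma base_sub A : F A -> exists a, B a `<=` A.
Proof. by rewrite F_base => -[a _ aA]; exists a. Qed.

Lemma base_almost_sub a b : ord_le a b -> finite_set (B b `\` B a).
Proof.
move=> ab; have [->|ne] := pselect (a = b); first by rewrite setDv.
by have [] := B_tower.2 a b (conj ab ne); rewrite /almost_subset setDE setCK setIC -setDE.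
Qed.

Lemma base_gap a b : ord_lt a b -> infinite_set (B a `\` B b).
Proof. by move=> /(B_tower.2) [_]; rewrite setDE setCK setIC -setDE. Qed.

Lemma free A : finite_set A -> ~ F A.
Proof.
move=> fA /base_sub[a aA]; have [b ab] := ord_no_max K_regular K_continuum a.
by apply: (base_gap ab); apply: sub_finite_set fA => n [/aA].
Qed.

Lemma base_pseudo_subset a b A : B a `<=` A -> ord_le a b ->
  exists N, forall n, N <= n -> B b n -> A n.
Proof.
move=> aA /base_almost_sub /finite_nat_bounded[N NP]; exists N => n Nn bn.
by apply: aA; apply: contrapT => an; have := NP n (conj bn an); rewrite ltnNge Nn.
Qed.

Section Injective.
Variables (s : nat -> point K) (g : seq nat).
Hypothesis s_inj : injective s.

Let trace (A : set nat) : set nat := [set i | exists2 j, A j & ray K g i = s j].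

Let finite_trace A : finite_set A -> finite_set (trace A).
Proof.
move=> fA; pose h j := if s j is inl u then size u - size g else 0.
apply: sub_finite_set (finite_image h fA) => i [j Aj ij]; exists j => //.
by rewrite /h -ij /ray size_cat size_nseq addKn.
Qed.

(* The gaps of the tower are almost disjoint, so at most one of them has a
   trace in [F]. *)
Lemma gap_trace (next : K -> K) : (forall a, ord_lt a (next a)) ->
  exists c, forall a, ord_le c a ->
    ~ F [set i | exists2 j, (B a `\` B (next a)) j & ray K g i = s j].
Proof.
move=> nextP; have [[c0 Fc]|nc] :=
    pselect (exists c, F (trace (B c `\` B (next c)))); last first.
  have [c _] := infinite_setN0 K_regular.1.
  by exists c => a _ Fa; apply: nc; exists a.
exists (next c0) => a ca Fa; apply: (free (finite_trace (base_almost_sub ca))).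
apply: filterS (filterI Fa Fc) => i [[j [aj _] ij] [j' [_ nj'] ij']].
by exists j => //; split=> //; rewrite (s_inj (etrans (esym ij) ij')).
Qed.

End Injective.

Variables (xi : K) (C : K -> code K).
Hypothesis adm : forall eta, ord_lt eta xi -> admissible F eta (local C eta) (C eta).

Let W := local C xi.

(** By [app_decide], [F] treats both sequences alike at each older neighbourhood, as a common limit
    requires; [app_miss] excludes an older common limit. *)
Record applicable (W : point K -> nat -> point K -> Prop) (s : bool -> nat -> point K) : Prop :=
  Applicable {
  app_below : forall b n, below xi (s b n);
  app_inj : forall b, injective (s b);
  app_miss : forall x, below xi x -> exists k, ~ F [set n | forall b, W x k (s b n)];
  app_decide : forall x k, below xi x -> F [set n | forall b, W x k (s b n)] \/
    F [set n | forall b, exists j, forall z, W (s b n) j z -> ~ W x k.+1 z] }.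

(** One [a] thins out both sequences. Being eventually in [B xi], it eventually enters every set
    that contains a base member of index at most [xi]. *)
Definition realizes (s : bool -> nat -> point K) (c : code K) : Prop :=
  exists a : nat -> nat, [/\ forall n, n <= a n, ev (fun n => B xi (a n)) &
    forall n b, c.1 n b = s b (a n)].

Lemma local_mono x k j y : j <= k -> W x k y -> W x j y.
Proof. by move=> jk [? ? h]; split=> //; exact: nb_mono h. Qed.

Lemma local_refl x k : below xi x -> W x k x.
Proof. by move=> bx; split=> //; exact: nb_refl. Qed.

Section Dominating.
Variable d : nat -> bool -> point K.
Hypothesis d_below : forall n b, below xi (d n b).

(** One function per older neighbourhood: so few arise that a single function dominates them all. *)
Lemma open_bound x k : exists f : nat -> nat, forall n b,
  W x k (d n b) -> forall z, W (d n b) (f n) z -> W x k z.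
Proof.
suff h n : exists j, forall b, W x k (d n b) -> forall z, W (d n b) j z -> W x k z.
  by have [f fP] := choice h; exists f.
apply: uniform_index_bool => [b i j ij h xd z dz|b].
  by apply: h => //; exact: local_mono dz.
have [[bx _ xd]|nx] := pselect (W x k (d n b)); last by exists 0 => /nx.
have [j jP] := nb_open adm bx (d_below n b) xd.
by exists j => _ z [_ bz /jP].
Qed.

Lemma regular_bound x k : exists f : nat -> nat, forall n b,
  (exists j, forall z, W (d n b) j z -> ~ W x k.+1 z) ->
  forall z, W (d n b) (f n) z -> ~ W x k.+1 z.
Proof.
suff h n : exists i, forall b, (exists j, forall z, W (d n b) j z -> ~ W x k.+1 z) ->
    forall z, W (d n b) i z -> ~ W x k.+1 z.
  by have [f fP] := choice h; exists f.
apply: uniform_index_bool => [b i j ij h xd z dz|b].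
  by apply: h => //; exact: local_mono dz.
have [[j jP]|nx] := pselect (exists j, forall z, W (d n b) j z -> ~ W x k.+1 z).
  by exists j.
by exists 0 => /nx.
Qed.

(** By [nb_miss] each term has a neighbourhood missing [F]-most of the ray, and one [beta] lies
    beyond the countably many base indices involved. [nb_T1] removes the finitely many exceptions
    other than the term itself. *)
Lemma miss_bound g : exists (f : nat -> nat) (beta : K), forall n b i,
  B beta i -> W (d n b) (f n) (ray K g i) -> ray K g i = d n b.
Proof.
have h (p : nat * bool) : exists ka : nat * K,
    B ka.2 `<=` [set i | ~ nb C (d p.1 p.2) ka.1 (ray K g i)].
  have [k /(ultra_setC UF)/base_sub[a aP]] :=
    nb_miss UF free adm g (d_below p.1 p.2).
  by exists (k, a).
have [ka kaP] := choice h.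
have [beta betaP] := small_countable K_regular K_continuum
  (countableP [set: nat * bool]) (fun p => (ka p).2).
suff h' n : exists j, forall b i,
    B beta i -> W (d n b) j (ray K g i) -> ray K g i = d n b.
  by have [f fP] := choice h'; exists f, beta.
apply: uniform_index_bool => [b i j ij P m Bm dm|b].
  by apply: P Bm _; exact: local_mono dm.
have [N NP] := base_pseudo_subset (kaP (n, b)) (betaP (n, b) I).1.
have [m i j ij P E|i iN|j jP] := @uniform_index
    (fun i j => W (d n b) j (ray K g i) -> ray K g i = d n b) N.
- by apply: P; exact: local_mono E.
- have [E|ne] := pselect (ray K g i = d n b); first by exists 0.
  have [j jP] := nb_T1 adm (d_below n b) (I : below xi (ray K g i)) (nesym ne).
  by exists j => -[_ _ /jP].
exists (maxn j (ka (n, b)).1) => i Bi dz; have [iN|Ni] := ltnP i N.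
  by apply: jP iN _; apply: local_mono dz; exact: leq_maxl.
case: (NP i Ni Bi); have [_ _] := dz; apply: nb_mono; exact: leq_maxr.
Qed.

End Dominating.

Lemma exists_admissible s : applicable W s ->
  exists c, admissible F xi W c /\ realizes s c.
Proof.
move=> [s_below s_inj s_miss s_decide].
have [next nextP] := choice (ord_no_max K_regular K_continuum).
(* Yields [alpha], the index of a base member deciding the neighbourhood [p] for both sequences. *)
have h1 (p : point K * nat) : exists a, below xi p.1 ->
    B a `<=` [set n | forall b, W p.1 p.2 (s b n)] \/
    B a `<=` [set n | forall b, exists j, forall z, W (s b n) j z -> ~ W p.1 p.2.+1 z].
  have [a0 _] := infinite_setN0 K_regular.1.
  have [bx|nb] := pselect (below xi p.1); last by exists a0.
  have [/base_sub[a aP]|/base_sub[a aP]] := s_decide _ p.2 bx.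
    by exists a; left.
  by exists a; right.
have [alpha alphaP] := choice h1.
have [c1 c1P] := small_fst K_regular K_continuum (J := nat)
  (small_below K_regular K_continuum xi) alpha.
have h2 (p : seq nat * bool) := gap_trace p.1 (s_inj p.2) nextP.
have [delta deltaP] := choice h2.
have [c2 c2P] := small_countable K_regular K_continuum
  (countableP [set: seq nat * bool]) delta.
have [c3 [c13 c23]] := ord_max2 K_regular K_continuum c1 c2.
(* [c] exceeds all deciding indices, all gap thresholds and [xi]. *)
have [c [c3c xic]] := ord_max2 K_regular K_continuum c3 xi.
have c1c := ord_lt_trans c13 c3c; have c2c := ord_lt_trans c23 c3c.
(* Choosing from a gap instead of [B c] leaves only an [F]-null trace on each ray, by [gap_trace];
   [adm_miss] needs this. *)
have ha n : exists m, n <= m /\ (B c `\` B (next c)) m.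
  have [m nm Bm] := infinite_nat_unbounded (base_gap (nextP c)) n.
  by exists m.
have [a aP] := choice ha.
have a_ev e A : B e `<=` A -> ord_le e c -> ev (fun n => A (a n)).
  move=> eA ec; have [N NP] := base_pseudo_subset eA ec; exists N => n Nn.
  have [na [Ba _]] := aP n; apply: NP => //; exact: leq_trans na.
pose d n b := s b (a n).
have d_below n b : below xi (d n b) by exact: s_below.
have [fo foP] := choice (fun p => open_bound d_below p.1 p.2).
have [fr frP] := choice (fun p => regular_bound d p.1 p.2).
have [fm fmP] := choice (miss_bound d_below).
pose D : set (point K * nat) := [set p | below xi p.1].
pose G := (fo @` D `|` fr @` D) `|` range fm.
have [f fP] : exists f, forall g, G g -> ev (fun n => g n <= f n).
  apply: small_dominated; apply: small_setU => //; last first.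
    by apply: small_image; exact: small_countable (countableP _).
  by apply: small_setU => //; apply: small_image; apply: small_fst => //;
     exact: small_below.
have decide x k : below xi x -> ev (fun n => forall b, W x k (d n b)) \/
    ev (fun n => forall b, exists j, forall z, W (d n b) j z -> ~ W x k.+1 z).
  move=> bx; have le := (ord_lt_trans (c1P (x, k) bx) c1c).1.
  by have [/a_ev h|/a_ev h] := alphaP (x, k) bx; [left|right]; exact: h le.
have W_below x k (P : nat -> bool -> point K) : ev (fun n => forall b, W x k (P n b)) -> below xi x.
  by move=> [N NP]; have [] := NP N (leqnn N) true.
exists (d, f); split; last first.
  exists a; split=> // [n|]; first by have [] := aP n.
  exact: a_ev (@subset_refl _ _) xic.1.
split=> //=.
- move=> x k h; have [N1 N1P] := h.
  have /fP[N2 N2P] : G (fo (x, k)).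
    by left; left; exists (x, k) => //=; exact: W_below h.
  exists (maxn N1 N2) => n; rewrite geq_max => /andP[n1 n2] b z dz.
  apply: (foP (x, k) n b) => /=; first exact: N1P.
  by apply: local_mono dz; exact: N2P.
- move=> x k h; have [bx|nb] := pselect (below xi x); last first.
    by exists 0 => n _ b z _ [].
  case: (decide x k bx) => // -[N1 N1P].
  have /fP[N2 N2P] : G (fr (x, k)).
    by left; right; exists (x, k).
  exists (maxn N1 N2) => n; rewrite geq_max => /andP[n1 n2] b z dz.
  apply: (frP (x, k) n b) => /=; first exact: N1P.
  by apply: local_mono dz; exact: N2P.
- move=> x; have [bx|nb] := pselect (below xi x); last first.
    by exists 0 => /W_below.
  (* At [k] the first alternative contradicts [app_miss]; the second separates late terms from the
     neighbourhood of index [k.+1]. *)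
  have [k kP] := s_miss _ bx; exists k.+1 => -[N NP].
  have le := (ord_lt_trans (c1P (x, k) bx) c1c).1.
  case: (alphaP (x, k) bx) => [/= aW|/a_ev /(_ le)[M MP]].
    by apply: kP; exact: filterS aW (base_in _).
  have [j jP] := MP _ (leq_maxr N M) true.
  by apply: (jP (d (maxn N M) true)); [exact: local_refl|apply: NP; exact: leq_maxl].
- move=> g; have [beta betaP] := fmP g.
  have /fP[N NP] : G (fm g).
    by right; exists g.
  exists N => Fm.
  (* At ray positions in [B beta], a late neighbourhood contains no ray point but its centre, which
     is a term indexed in the gap. *)
  have : F [set m | exists b, exists2 j, (B c `\` B (next c)) j & ray K g m = s b j].
    apply: filterS (filterI Fm (base_in beta)) => m [[n [b [Nn dm]]] bm].
    exists b, (a n); first by have [] := aP n.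
    by apply: betaP bm _; apply: local_mono dm; exact: NP.
  move=> /(ultra_bool UF)[b]; apply: (deltaP (g, b)).
  exact: (ord_lt_trans (c2P (g, b) I) c2c).1.
Qed.

End Stage.

(** * Available tasks and the recursion over all stages *)

Section Coding.
Variables (K : cardinal) (F : set_system nat) (B : K -> set nat).
Hypotheses (K_regular : regular_cardinal K) (K_continuum : is_continuum K).
Hypothesis small_dominated : forall G : set (nat -> nat), small K G ->
  exists f, forall g, G g -> ev (fun n => g n <= f n).
Hypotheses (UF : UltraFilter F) (F_base : F = filter_from [set: K] B).
Hypothesis B_tower : tower (fun a => ~` B a).

Let F_free : forall A, finite_set A -> ~ F A :=
  free K_regular K_continuum F_base B_tower.

Lemma ray_inj g : injective (ray K g).
Proof.
move=> m n [/(congr1 size)]; rewrite !size_cat !size_nseq; exact: addnI.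
Qed.

Section Applicable.
Variables (xi : K) (C : K -> code K).
Hypothesis adm : forall eta, ord_lt eta xi -> admissible F eta (local C eta) (C eta).

Lemma applicable_same s : (forall n, below xi (s n)) -> injective s ->
  (forall x, below xi x -> exists k, ~ F [set n | nb C x k (s n)]) ->
  applicable F xi (local C xi) (fun=> s).
Proof.
move=> bs s_inj s_miss; split=> // [x bx|x k bx].
  have [k kP] := s_miss x bx; exists k; apply: contra_not kP.
  by apply: filterS => n /(_ true) [].
have [Fk|/(ultra_setC UF) Fk] := pselect (F [set n | nb C x k (s n)]).
  by left; apply: filterS Fk => n h _; split.
right; apply: filterS Fk => n h _; have [j jP] := nb_regular adm bx (bs n) h.
by exists j => z [_ _ /jP h'] [].
Qed.

Lemma applicable_ray g : applicable F xi (local C xi) (fun=> ray K g).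
Proof.
apply: applicable_same => [//||x bx]; first exact: ray_inj.
exact: (nb_miss UF F_free adm g bx).
Qed.

(** If a neighbourhood of index [k] does not hold [F]-most of both rays, [nb_adjacent] shows that
    index [k.+1] holds [F]-most of neither; [nb_regular_seq] then separates at no further cost. *)
Lemma applicable_adjacent g g' : adjacent g g' ->
  applicable F xi (local C xi) (fun b => ray K (if b then g else g')).
Proof.
move=> gg'; split=> // [b|x bx|x k bx].
- exact: ray_inj.
- have [k kP] := nb_miss UF F_free adm g bx; exists k; apply: contra_not kP.
  by apply: filterS => n /(_ true) [].
pose P b := F [set n | nb C x k (ray K (if b then g else g') n)].
have [[Pt Pf]|nP] := pselect (P true /\ P false).
  by left; apply: filterS (filterI Pt Pf) => n [nt nf] [].
right.
have nS b : ~ F [set n | nb C x k.+1 (ray K (if b then g else g') n)].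
  move=> Pb; apply: nP.
  have Pb' : P b by apply: filterS Pb => n; exact: nb_mono.
  case: b Pb Pb' => Pb Pb'; split=> //; apply: (nb_adjacent UF F_free adm bx _ Pb).
    by left.
  by right.
apply: filterS (filterI (ultra_setC UF (nS true)) (ultra_setC UF (nS false))).
move=> n [nt nf] b.
have {nt nf} : ~ nb C x k.+1 (ray K (if b then g else g') n) by case: b.
move=> /(nb_regular_seq adm bx)[j jP]; exists j => z [_ _ /jP h] [_ _]; exact: h.
Qed.

End Applicable.

Variable task : K -> bool -> nat -> point K.

Lemma exists_coding : exists C : K -> code K, forall xi,
  admissible F xi (local C xi) (C xi) /\
  (applicable F xi (local C xi) (task xi) -> realizes B xi (task xi) (C xi)).
Proof.
(* When the scheduled task does not apply, a harmless one is carried out, so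
   that every stage adds a point. *)
pose task' (xi : K) W : bool -> nat -> point K :=
  if pselect (applicable F xi W (task xi)) then task xi else fun=> ray K [::].
pose good (xi : K) W c := admissible F xi W c /\ realizes B xi (task' xi W) c.
suff [C CP] : exists C : K -> code K, forall xi, good xi (local C xi) (C xi).
  exists C => xi; have [aC rC] := CP xi; split=> // app.
  by move: rC; rewrite /task'; case: pselect.
(* Good codes exist only once earlier stages are admissible, so [G] returns a default where none
   exists. *)
have h (p : K * (point K -> nat -> point K -> Prop)) :
    exists c, (exists c', good p.1 p.2 c') -> good p.1 p.2 c.
  have [[c cP]|nc] := pselect (exists c', good p.1 p.2 c'); first by exists c.
  by exists (fun _ _ => inl [::], fun=> 0).
have [G GP] := choice h.
(* By [nb_local] the codes from [xi] on do not affect stage [xi], so any default may fill them. *)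
pose extend (xi : K) (rec : forall eta, ord_lt eta xi -> code K) eta : code K :=
  if pselect (ord_lt eta xi) is left lt then rec eta lt else (fun _ _ => inl [::], fun=> 0).
pose C := Fix (@ord_lt_wf K) (fun=> code K)
  (fun xi rec => G (xi, local (extend xi rec) xi)).
exists C; elim/(well_founded_ind (@ord_lt_wf K)) => xi IH.
have CE : C xi = G (xi, local (extend xi (fun eta _ => C eta)) xi).
  rewrite /C Fix_eq // => eta r r' rr'; congr (G (_, local (extend _ _) _)).
  by apply: functional_extensionality_dep => a; apply/funext => p.
have agree eta : ord_lt eta xi -> C eta = extend xi (fun eta _ => C eta) eta.
  by rewrite /extend; case: pselect.
have locE : local (extend xi (fun eta _ => C eta)) xi = local C xi.
  apply/funext => x; apply/funext => k; apply/funext => y; apply/propext.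
  by split=> -[bx by_ xy]; split=> //; apply: (nb_local _ bx by_ xy) => eta /agree.
rewrite CE locE; apply: (GP (xi, _)) => /=.
have adm eta : ord_lt eta xi -> admissible F eta (local C eta) (C eta).
  by move=> /IH[].
apply: (exists_admissible K_regular K_continuum small_dominated UF F_base B_tower adm).
rewrite /task'; case: pselect => [//|na]; exact: applicable_ray.
Qed.

End Coding.

(** * The topology of a countable local base *)

Record is_local_base (T : Type) (V : T -> nat -> set T) : Prop := IsLocalBase {
  base_refl : forall x k, V x k x;
  base_mono : forall x j k, j <= k -> V x k `<=` V x j;
  base_open : forall x y k, V x k y -> exists j, V y j `<=` V x k }.

(** An alias of [T] that mentions [baseV], so that the topology can be attached to it. *)
Definition based_space (T : Type) (V : T -> nat -> set T) (baseV : is_local_base V) : Type := T.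

Section BasedSpace.
Variables (T : Type) (V : T -> nat -> set T) (baseV : is_local_base V).
Local Notation X := (based_space baseV).

HB.instance Definition _ := gen_eqMixin X.
HB.instance Definition _ := gen_choiceMixin X.
HB.instance Definition _ := hasNbhs.Build X (fun x : X => filter_from [set: nat] (V x)).

Let based_filter (x : X) : ProperFilter (nbhs x).
Proof.
apply: filter_from_proper => [|k _]; last by exists x; exact: base_refl.
apply: filter_from_filter => [|i j _ _]; first by exists 0.
exists (maxn i j) => // y xy; split; apply: (base_mono baseV) xy.
  exact: leq_maxl.
exact: leq_maxr.
Qed.

Let based_singleton (x : X) (A : set X) : nbhs x A -> A x.
Proof. by move=> [k _]; apply; exact: base_refl. Qed.

Let based_nbhs (x : X) (A : set X) : nbhs x A -> nbhs x (nbhs^~ A).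
Proof.
move=> [k _ kA]; exists k => // y /(base_open baseV)[j jk]; exists j => //.
exact: subset_trans jk kA.
Qed.

HB.instance Definition _ :=
  Nbhs_isNbhsTopological.Build X based_filter based_singleton based_nbhs.

Lemma based_nbhsP (x : X) (A : set X) : nbhs x A <-> exists k, V x k `<=` A.
Proof. by split=> [[k _ kA]|[k kA]]; exists k. Qed.

Lemma based_open (x : X) k : open (V x k : set X).
Proof.
by rewrite openE => y /(base_open baseV)[j jk]; apply/based_nbhsP; exists j.
Qed.

Lemma based_first_countable : first_countable X.
Proof.
move=> x; exists (range (V x)).
  by apply: card_le_trans (card_image_le _ _) _; exact: countableP.
apply/seteqP; split=> A; first by move=> [k _ kA]; exists (V x k); first by exists k.
by move=> [_ [k _ <-] kA]; exists k.
Qed.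

(** The hypothesis places the closure of [V x k.+1] inside [V x k]. *)
Lemma based_regular : (forall x y k, ~ V x k y -> exists j, V y j `&` V x k.+1 = set0) ->
  regular_space X.
Proof.
move=> reg x A /based_nbhsP[k kA]; exists (V x k.+1).
  by apply/based_nbhsP; exists k.+1.
move=> y cy; apply: kA; apply: contrapT => /reg[j j0].
have [|z [xz yz]] := cy (V y j : set X); first by apply/based_nbhsP; exists j.
suff : (V y j `&` V x k.+1) z by rewrite j0.
by [].
Qed.

Lemma based_accessible : (forall x y, x <> y -> exists k, ~ V x k y) -> accessible_space X.
Proof.
move=> sep x y /eqP/sep[k kP]; exists (V x k); split; first exact: based_open.
  by apply: mem_set; exact: base_refl.
exact: mem_set.
Qed.

End BasedSpace.

(** * The space is a Nyikos space *)

Section Space.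
Variables (R : realType) (K : cardinal) (F : set_system nat) (B : K -> set nat).
Hypotheses (K_regular : regular_cardinal K) (K_continuum : is_continuum K).
Hypotheses (UF : UltraFilter F) (F_base : F = filter_from [set: K] B).
Hypothesis B_tower : tower (fun a => ~` B a).
Variable task : K -> bool -> nat -> point K.
Hypothesis task_cofinal : forall s xi, exists2 eta, ord_lt xi eta & task eta = s.
Variable C : K -> code K.
Hypothesis C_adm : forall xi, admissible F xi (local C xi) (C xi).
Hypothesis C_task : forall xi,
  applicable F xi (local C xi) (task xi) -> realizes B xi (task xi) (C xi).

Let F_free : forall A, finite_set A -> ~ F A :=
  free K_regular K_continuum F_base B_tower.

Let common_stage (x y : point K) : exists2 xi, below xi x & below xi y.
Proof.
have [c cP] := small_countable K_regular K_continuum (countableP [set: bool])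
  (fun b => if (if b then x else y) is inr eta then eta
            else projT1 (cid (infinite_setN0 K_regular.1))).
exists c; first by have := cP true I; case: (x).
by have := cP false I; case: (y).
Qed.

Let adm xi (eta : K) (_ : ord_lt eta xi) : admissible F eta (local C eta) (C eta) := C_adm eta.

Lemma nb_local_base : is_local_base (nb C).
Proof.
split=> [x k|x j k jk y|x y k xy]; first exact: nb_refl.
  exact: nb_mono.
have [xi bx by_] := common_stage x y.
exact: (nb_open (adm (xi := xi)) bx by_ xy).
Qed.

Local Notation X := (based_space nb_local_base).

Lemma nb_dense x k : exists e, nb C x k (inl e).
Proof.
elim/point_ind: x k => [e|xi IH] k; first by exists e; exact: nb_refl.
have p := adm_below (C_adm xi).
have [e he] := IH _ (p k true) ((C xi).2 k + k).
by exists e; exact: (nb_fan p _ (leqnn k) he).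
Qed.

Lemma space_separable : separable_space X.
Proof.
exists (range (inl : seq nat -> X)).
  by apply: card_le_trans (card_image_le _ _) _; exact: countableP.
move=> U [x Ux] oU; have [k kU] : exists k, nb C x k `<=` U.
  by apply/(@based_nbhsP _ _ nb_local_base); exact: open_nbhs_nbhs.
have [e he] := nb_dense x k; exists (inl e); split; last by exists e.
exact: kU.
Qed.

Lemma space_regular : regular_space X.
Proof.
apply: based_regular => x y k nxy; have [xi bx by_] := common_stage x y.
have [j jP] := nb_regular (adm (xi := xi)) bx by_ nxy.
by exists j; apply/seteqP; split=> // z [/jP].
Qed.

Lemma space_accessible : accessible_space X.
Proof.
apply: based_accessible => x y; have [xi bx by_] := common_stage x y.
exact: (nb_T1 (adm (xi := xi)) bx by_).
Qed.

Lemma sequence_below (s : nat -> point K) : exists xi, forall n, below xi (s n).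
Proof.
have [a0 _] := infinite_setN0 K_regular.1.
have [c cP] := small_countable K_regular K_continuum (countableP [set: nat])
  (fun n => if s n is inr eta then eta else a0).
by exists c => n; have := cP n I; case: (s n).
Qed.

(** Either the sequence has an [F]-limit, which is a cluster point as [F] is free, or its task
    applies at a later stage and adds a cluster point. *)
Lemma sequence_cluster (s : nat -> point K) : injective s ->
  exists x, forall k N, exists2 n, N <= n & nb C x k (s n).
Proof.
move=> s_inj; have [xi0 s0] := sequence_below s.
have [xi xi0xi task_s] := task_cofinal (fun=> s) xi0.
have s_below n : below xi (s n) by exact: below_trans (s0 n) _.
have [s_miss|] := pselect (forall x, below xi x -> exists k, ~ F [set n | nb C x k (s n)]).
  have := @C_task xi; rewrite task_s => /(_ _)[|a [na _ da]].
    exact: (applicable_same UF (adm (xi := xi))).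
  have p := adm_below (C_adm xi).
  exists (inr xi) => k N; exists (a (maxn k N)).
    exact: leq_trans (leq_maxr k N) (na _).
  rewrite -(da _ true); apply: (nb_fan p (p _ true) (leq_maxl k N)).
  exact: nb_refl.
move=> /existsNP[x /not_implyP[bx /forallNP xF]]; exists x => k N.
have /contrapT Fk := xF k; apply: contrapT => h.
apply: (F_free (@finite_II N)); apply: filterS Fk => n xn /=.
by rewrite ltnNge; apply/negP => Nn; apply: h; exists n.
Qed.

Lemma space_countably_compact : countably_compact X.
Proof.
move=> U oU cU; apply: contrapT => nfin.
have h n : exists x : X, forall i, i < n -> ~ U i x.
  apply: contrapT => h; apply: nfin; exists (fset_set `I_n) => [i _|x _].
    exact: mem_set.
  apply: contrapT => nx; apply: h; exists x => i lt Uix; apply: nx; exists i => //.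
  by rewrite /= in_fset_set; [exact: mem_set|exact: finite_II].
have [x xP] := choice h.
have hU (y : X) : exists i, U i y by have [i _ Uiy] := cU y I; exists i.
have [idx idxP] := choice hU.
(* Jumping past the index of a set containing the current point makes [idx] strictly increase along
   [x \o m], so this sequence is injective. *)
pose m k := iter k (fun n => (idx (x n)).+1) 0.
have idx_ge n : n <= idx (x n).
  by rewrite leqNgt; apply/negP => /xP; apply; exact: idxP.
have m_lt k : idx (x (m k)) < m k.+1 by [].
have m_ge k : k <= m k.
  by elim: k => // k IH; apply: leq_trans (m_lt k); rewrite ltnS (leq_trans IH).
have idx_lt k j : k < j -> idx (x (m k)) < idx (x (m j)).
  move=> /subnK <-; elim: (j - k.+1) => [|i IH]; first exact: idx_ge.
  by apply: ltn_trans IH _; exact: idx_ge.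
have [|y yP] := @sequence_cluster (x \o m).
  move=> k j /= E; have [kj|jk|//] := ltngtP k j.
    by have := idx_lt _ _ kj; rewrite E ltnn.
  by have := idx_lt _ _ jk; rewrite E ltnn.
have [k kU] : exists k, nb C y k `<=` U (idx y).
  apply/(@based_nbhsP _ _ nb_local_base); apply: open_nbhs_nbhs; split; first exact: oU.
  exact: idxP.
have [n ny /kU] := yP k (idx y).+1.
by apply: xP; apply: leq_trans (m_ge n).
Qed.

Lemma nbhs_ltr (f : X -> R) x q : continuous f -> (f x < q)%R ->
  exists k, forall y, nb C x k y -> (f y < q)%R.
Proof.
move=> cf xq; have /(cf x) : nbhs (f x) [set r | (r < q)%R].
  by apply: open_nbhs_nbhs; split=> //; exact: open_lt.
by move=> /(@based_nbhsP _ _ nb_local_base)[k kP]; exists k.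
Qed.

Lemma nbhs_gtr (f : X -> R) x q : continuous f -> (q < f x)%R ->
  exists k, forall y, nb C x k y -> (q < f y)%R.
Proof.
move=> cf xq; have /(cf x) : nbhs (f x) [set r | (q < r)%R].
  by apply: open_nbhs_nbhs; split=> //; exact: open_gt.
by move=> /(@based_nbhsP _ _ nb_local_base)[k kP]; exists k.
Qed.

(** The task of the two rays recurs at a stage [xi] so late that [B xi] is almost contained in both
    [A] and [A']. *)
Lemma sequences_common_limit g g' (A A' : set nat) : adjacent g g' -> F A -> F A' ->
  exists x, forall k, exists n n', [/\ A n, A' n', nb C x k (ray K g n) &
    nb C x k (ray K g' n')].
Proof.
move=> gg' FA FA'.
have [a aA] := base_sub F_base FA; have [a' a'A'] := base_sub F_base FA'.
have [c [ac a'c]] := ord_max2 K_regular K_continuum a a'.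
have [xi cxi task_xi] := task_cofinal (fun b => ray K (if b then g else g')) c.
have := @C_task xi; rewrite task_xi => /(_ _)[|u [nu [M uM] du]].
  exact: (applicable_adjacent K_regular K_continuum UF F_base B_tower (adm (xi := xi))).
have [N NP] := base_pseudo_subset B_tower aA (ord_lt_trans ac cxi).1.
have [N' NP'] := base_pseudo_subset B_tower a'A' (ord_lt_trans a'c cxi).1.
have p := adm_below (C_adm xi).
exists (inr xi) => k; pose n := maxn (maxn N N') (maxn M k).
have [Nn N'n Mn kn] : [/\ N <= n, N' <= n, M <= n & k <= n].
  by split; rewrite /n !leq_max leqnn ?orbT.
have fan b : nb C (inr xi) k (ray K (if b then g else g') (u n)).
  rewrite -(du n b); apply: (nb_fan p (p _ b) kn); exact: nb_refl.
exists (u n), (u n); split; last 2 first.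
- exact: (fan true).
- exact: (fan false).
- by apply: NP (uM n Mn); exact: leq_trans (nu n).
- by apply: NP' (uM n Mn); exact: leq_trans (nu n).
Qed.

(** * Rigidity *)

Section Rigid.
Variable f : X -> R.
Hypothesis f_cont : continuous f.

(* The cut of the limit of [f] along [F] transported to the ray of [g]. *)
Let cut g q := F [set n | (f (ray K g n) < q)%R].

(** Says that the [F]-limit for [g'] is at most that for [g]; the slack between [q] and [q'] absorbs
    the behaviour of a cut at its limit. *)
Let cut_le g g' := forall q q', (q < q')%R -> cut g q -> cut g' q'.

Let cut_trans g h g' : cut_le g h -> cut_le h g' -> cut_le g g'.
Proof.
move=> gh hg' q q' qq' cg.
apply: (hg' ((q + q') / 2)%R); first by rewrite midf_lt.
by apply: gh cg; rewrite midf_lt.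
Qed.

(** Otherwise one ray stays below [q] and the other at or above [q'] along members of [F], and no
    value of [f] at a common limit fits both. *)
Let cut_adjacent g g' : adjacent g g' -> cut_le g g' /\ cut_le g' g.
Proof.
move=> gg'; split=> q q' qq' cq; apply: contrapT => /(ultra_setC UF) ncq.
  have [x xP] := sequences_common_limit gg' cq ncq.
  have [xq|qx] := ltP (f x) q'.
    have [k kP] := nbhs_ltr f_cont xq; have [n [n' [_ nf _ xn']]] := xP k.
    by apply: nf; exact: kP.
  have [k kP] := nbhs_gtr f_cont (lt_le_trans qq' qx).
  have [n [n' [/= fn _ xn _]]] := xP k.
  by have := lt_trans fn (kP _ xn); rewrite ltxx.
have [x xP] := sequences_common_limit gg' ncq cq.
have [xq|qx] := ltP (f x) q'.
  have [k kP] := nbhs_ltr f_cont xq; have [n [n' [nf _ xn _]]] := xP k.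
  by apply: nf; exact: kP.
have [k kP] := nbhs_gtr f_cont (lt_le_trans qq' qx).
have [n [n' [_ /= fn _ xn]]] := xP k.
by have := lt_trans fn (kP _ xn); rewrite ltxx.
Qed.

(** Lowering the last entry to zero and then deleting it leads from [g] to the root through adjacent
    sequences. *)
Let cut_root g : cut_le g [::] /\ cut_le [::] g.
Proof.
elim/last_ind: g => [|h i [hr rh]].
  by split=> q q' qq'; apply: filterS => n /lt_trans; apply.
elim: i => [|i [ir ri]].
  have [h0 h1] : cut_le h (rcons h 0) /\ cut_le (rcons h 0) h by apply: cut_adjacent; right.
  by split; [exact: cut_trans hr|exact: cut_trans h0].
have [h0 h1] : cut_le (rcons h i) (rcons h i.+1) /\ cut_le (rcons h i.+1) (rcons h i).
  by apply: cut_adjacent; left; exists h, i.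
by split; [exact: cut_trans ir|exact: cut_trans h0].
Qed.

Let seq_le e e' : (f (inl e') <= f (inl e))%R.
Proof.
rewrite leNgt; apply/negP => lt.
pose q := ((f (inl e) + f (inl e')) / 2)%R; pose q' := ((q + f (inl e')) / 2)%R.
have eq : (f (inl e) < q)%R by rewrite midf_lt.
have qe' : (q < f (inl e'))%R by rewrite midf_lt.
have qq' : (q < q')%R by rewrite midf_lt.
have q'e' : (q' < f (inl e'))%R by rewrite midf_lt.
(* Each neighbourhood of [u] contains a whole ray, so its cut reflects the value of [f] at [u]. *)
have near_ray u k n : nb C (inl u) k (ray K (rcons u k) n).
  by apply: nb_ray; rewrite ?size_rcons // -?cats1 ?take_size_cat // nth_cat ltnn subnn.
have [k kP] := nbhs_ltr f_cont eq; have [k' kP'] := nbhs_gtr f_cont q'e'.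
have cq : cut (rcons e k) q by apply: filterS filterT => n _; exact: kP.
have : cut (rcons e' k') q'.
  exact: cut_trans (cut_root _).1 (cut_root _).2 _ _ qq' cq.
move=> /filter_ex[n /= fn]; have := lt_trans fn (kP' _ (near_ray _ _ n)).
by rewrite ltxx.
Qed.

Lemma rigid_const x : f x = f (inl [::]).
Proof.
have seqE e : f (inl e) = f (inl [::]) by apply/eqP; rewrite eq_le !seq_le.
apply: contrapT => /eqP; rewrite neq_lt => /orP[lt|lt].
  have [k kP] := nbhs_ltr f_cont lt; have [e /kP] := nb_dense x k.
  by rewrite seqE ltxx.
have [k kP] := nbhs_gtr f_cont lt; have [e /kP] := nb_dense x k.
by rewrite seqE ltxx.
Qed.

End Rigid.

Lemma space_R_rigid : R_rigid R X.
Proof. by move=> f cf x y; rewrite !rigid_const. Qed.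

End Space.

Theorem theorem5p2 (R : realType) (omega1 t b c : cardinal)
    (omega1P : is_omega1 omega1) (tP : is_tower_number t)
    (bP : is_bounding_number b) (cP : is_continuum c)
    (omega1_eq_t : cardinal_eq omega1 t) (t_lt_b : cardinal_lt t b)
    (b_eq_c : cardinal_eq b c)
    (P_point : exists F : set_system nat, simple_P_point c F) :
  exists X : topologicalType,
    [/\ Nyikos_space X, (exists x y : X, x <> y) & R_rigid R X].
Proof.
have [F [c_regular UF [B [F_base B_tower]]]] := P_point.
have dom G := @small_bounded c c_regular b G bP b_eq_c.
have [task task_cofinal] := cofinal_enumeration c_regular cP.
have [C CP] := exists_coding c_regular cP dom UF F_base B_tower task.
have C_adm xi := (CP xi).1; have C_task xi := (CP xi).2.
exists (based_space (nb_local_base c_regular cP C_adm)); split.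
- split; split.
  + exact: space_regular.
  + exact: space_accessible.
  + exact: space_separable.
  + exact: based_first_countable.
  + exact: (space_countably_compact UF F_base B_tower task_cofinal C_task).
- by exists (inl [::]), (inl [:: 0]).
- exact: (space_R_rigid UF F_base B_tower task_cofinal C_task).
Qed.
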